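(* Let $\mathbf{K}\in\mathcal{K}$ be a spurious stationary point of $\mathcal{J}$, i.e. $\nabla\mathcal{J}(\mathbf{K})=0$ and $\mathcal{J}(\mathbf{K})>\mathcal{J}^\star$. Then $\tau(\mathbf{K})>1$.
   Context: Setting. $\{\rho_1,\dots,\rho_S\}$ is a finite grid with weights $\nu_s>0$, $\sum_{s=1}^S\nu_s=1$. $w_1,\dots,w_N$ are continuous weighting functions with $w_i(\rho)\ge 0$ and $\sum_{i=1}^N w_i(\rho)=1$; $A(\rho)=\sum_i w_i(\rho)A_i$ and $B(\rho)=\sum_i w_i(\rho)B_i$ with $A_i\in\mathbb{R}^{n\times n}$, $B_i\in\mathbb{R}^{n\times m}$. The matrices $Q,\Sigma_0\in\mathbb{R}^{n\times n}$ and $R\in\mathbb{R}^{m\times m}$ are symmetric positive definite. A gain $K\in\mathbb{R}^{m\times n}$ stabilizes plant $s$ if $A_{\mathrm{cl}}=A(\rho_s)-B(\rho_s)K$ is Schur stable (spectral radius $<1$). For such $K$: $P$ is the solution of $P=A_{\mathrm{cl}}^\top P A_{\mathrm{cl}}+Q+K^\top RK$; $\Sigma$ is the solution of $\Sigma=A_{\mathrm{cl}}\Sigma A_{\mathrm{cl}}^\top+\Sigma_0$; $J_s(K)=\operatorname{tr}(P\Sigma_0)$; $H=R+B(\rho_s)^\top PB(\rho_s)$; $E=HK-B(\rho_s)^\top PA(\rho_s)$. A schedule is a tuple $\mathbf{K}=(K_1,\dots,K_N)$ of matrices in $\mathbb{R}^{m\times n}$; its deployed gain at grid point $s$ is $K_{\mathbf{K}}(\rho_s)=\sum_i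 w_i(\rho_s)K_i$. The feasible set is the open set $\mathcal{K}=\{\mathbf{K}: K_{\mathbf{K}}(\rho_s)\text{ stabilizes plant } s,\ s=1,\dots,S\}$, and the scheduled cost is $\mathcal{J}(\mathbf{K})=\sum_s\nu_s J_s(K_{\mathbf{K}}(\rho_s))$ on $\mathcal{K}$. Write $P_s,\Sigma_s,E_s,H_s$ for the matrices $P,\Sigma,E,H$ of plant $s$ at the deployed gain $K=K_{\mathbf{K}}(\rho_s)$. The gradient $\nabla\mathcal{J}(\mathbf{K})$ has blocks $\nabla_{K_i}\mathcal{J}(\mathbf{K})=2\sum_s\nu_s w_i(\rho_s)E_s\Sigma_s$. Standing assumptions: $\mathcal{K}\ne\emptyset$ and $G_w=\sum_s\nu_s w(\rho_s)w(\rho_s)^\top\succ0$, where $w(\rho)=(w_1(\rho),\dots,w_N(\rho))^\top$. Under these, $\mathcal{J}$ attains its minimum over $\mathcal{K}$; $\mathbf{K}^\star\in\mathcal{K}$ denotes a fixed minimizer, $\mathcal{J}^\star=\mathcal{J}(\mathbf{K}^\star)$, and $\Sigma_s^\star$ is the covariance $\Sigma$ of plant $s$ at the gain $K_{\mathbf{K}^\star}(\rho_s)$. The inner product is $\langle X,Y\rangle=\operatorname{tr}(X^\top Y)$, summed over the tuple. The starred gradient $\nabla^{\star}\mathcal{J}(\mathbf{K})$ is the tuple with blocks $\nabla^{\star}_{K_i}\mathcal{J}(\mathbf{K})=2\sum_s\nu_s w_i(\rho_s)E_s\Sigma_s^\star$ (with $E_s$ evaluated at $\mathbf{K}$). With $\Delta_s=K_{\mathbf{K}}(\rho_s)-K_{\mathbf{K}^\star}(\rho_s)$,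 $Q_H(\mathbf{K})=\sum_s\nu_s\operatorname{tr}(\Sigma_s^\star\Delta_s^\top H_s\Delta_s)$, which is positive for $\mathbf{K}\neq\mathbf{K}^\star$. The remainder field is $\boldsymbol{\mathcal{R}}(\mathbf{K})=\tfrac12(\nabla^{\star}\mathcal{J}(\mathbf{K})-\nabla\mathcal{J}(\mathbf{K}))$, and for $\mathbf{K}\ne\mathbf{K}^\star$ the mismatch ratio is $\tau(\mathbf{K})=2\langle\boldsymbol{\mathcal{R}}(\mathbf{K}),\mathbf{K}-\mathbf{K}^\star\rangle/Q_H(\mathbf{K})$. *)

(* Defs.v *)
From HB Require Import structures.
From mathcomp Require Import all_boot all_order all_algebra.
From mathcomp Require Import complex.
From mathcomp Require Import all_classical all_reals all_analysis.
Set Implicit Arguments.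
Unset Strict Implicit.
Unset Printing Implicit Defensive.
Import Order.TTheory GRing.Theory Num.Theory.
Import numFieldNormedType.Exports.
Local Open Scope classical_set_scope.
Local Open Scope ring_scope.

Definition posdef (R : realType) (n : nat) (M : 'M[R]_n) : Prop :=
  M^T = M /\ forall x : 'cV[R]_n, x != 0 -> 0 < (x^T *m M *m x) 0 0.

(* The eigenvalues are the complex ones.  The set is finite, so the supremum is
   a maximum; for n = 0 it is empty and the supremum is 0. *)
Definition spectral_radius (R : realType) (n : nat) (M : 'M[R]_n) : R :=
  sup [set ComplexField.Normc.normc l |
       l in [set l : R[i] | eigenvalue (map_mx (real_complex R) M) l]].

Definition schur_stable (R : realType) (n : nat) (M : 'M[R]_n) : Prop :=
  spectral_radius M < 1.

(* The solution X of X = F X F^T + M.  It exists and is unique when F is Schur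
   stable, the only case in which this term is meaningful. *)
Definition lyap_sol (R : realType) (n : nat) (F M : 'M[R]_n) : 'M[R]_n :=
  xget 0 [set X | X = F *m X *m F^T + M].

Record problem (R : realType) (T : topologicalType) (n m N S : nat) := Problem {
  rho : 'I_S -> T;
  nu : 'I_S -> R;
  w : 'I_N -> T -> R;
  Avert : 'I_N -> 'M[R]_n;
  Bvert : 'I_N -> 'M[R]_(n, m);
  Qcost : 'M[R]_n;
  Rcost : 'M[R]_m;
  Sigma0 : 'M[R]_n
}.

Section Problem.
Variables (R : realType) (T : topologicalType) (n m N S : nat).
Variable d : problem R T n m N S.

Definition Arho (r : T) : 'M[R]_n := \sum_(i < N) w d i r *: Avert d i.
Definition Brho (r : T) : 'M[R]_(n, m) := \sum_(i < N) w d i r *: Bvert d i.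

Definition wvec (r : T) : 'cV[R]_N := \col_i w d i r.
Definition Gw : 'M[R]_N :=
  \sum_(s < S) nu d s *: (wvec (rho d s) *m (wvec (rho d s))^T).

Section Plant.
Variables (s : 'I_S) (K : 'M[R]_(m, n)).

Definition Acl : 'M[R]_n := Arho (rho d s) - Brho (rho d s) *m K.
Definition stabilizes : Prop := schur_stable Acl.
Definition Pmx : 'M[R]_n := lyap_sol Acl^T (Qcost d + K^T *m Rcost d *m K).
Definition Sigmamx : 'M[R]_n := lyap_sol Acl (Sigma0 d).
Definition plant_cost : R := \tr (Pmx *m Sigma0 d).
Definition Hmx : 'M[R]_m :=
  Rcost d + (Brho (rho d s))^T *m Pmx *m Brho (rho d s).
Definition Emx : 'M[R]_(m, n) :=
  Hmx *m K - (Brho (rho d s))^T *m Pmx *m Arho (rho d s).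

End Plant.

Definition inner (X Y : {ffun 'I_N -> 'M[R]_(m, n)}) : R :=
  \sum_(i < N) \tr ((X i)^T *m Y i).

Implicit Types K Kstar : {ffun 'I_N -> 'M[R]_(m, n)}.

Definition deployed K (s : 'I_S) : 'M[R]_(m, n) :=
  \sum_(i < N) w d i (rho d s) *: K i.

Definition feasible : set {ffun 'I_N -> 'M[R]_(m, n)} :=
  [set K | forall s, stabilizes s (deployed K s)].

Definition sched_cost K : R :=
  \sum_(s < S) nu d s * plant_cost s (deployed K s).

Definition is_minimizer Kstar : Prop :=
  feasible Kstar /\ forall K, feasible K -> sched_cost Kstar <= sched_cost K.

Definition unit_schedule (i : 'I_N) (a : 'I_m) (b : 'I_n) :
    {ffun 'I_N -> 'M[R]_(m, n)} :=
  [ffun j => if j == i then delta_mx a b else 0].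

(* The gradient for [inner]: the entries of its blocks are the partial
   derivatives of the cost.  The feasible set is open, so at a feasible K they
   do not depend on the values of [sched_cost] at infeasible schedules. *)
Definition grad K : {ffun 'I_N -> 'M[R]_(m, n)} :=
  [ffun i => \matrix_(a < m, b < n)
     derive1 (fun t : R => sched_cost (K + t *: unit_schedule i a b)) 0].

Definition grad_star Kstar K : {ffun 'I_N -> 'M[R]_(m, n)} :=
  [ffun i => 2 *: \sum_(s < S) (nu d s * w d i (rho d s)) *:
     (Emx s (deployed K s) *m Sigmamx s (deployed Kstar s))].

Definition QH Kstar K : R :=
  \sum_(s < S) nu d s *
    let Delta := deployed K s - deployed Kstar s in
    \tr (Sigmamx s (deployed Kstar s) *m Delta^T *m Hmx s (deployed K s)
         *m Delta).

Definition remainder Kstar K : {ffun 'I_N -> 'M[R]_(m, n)} :=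
  2^-1 *: (grad_star Kstar K - grad K).

Definition mismatch Kstar K : R :=
  2 * inner (remainder Kstar K) (K - Kstar) / QH Kstar K.

Definition spurious_stationary Kstar K : Prop :=
  [/\ feasible K, grad K = 0 & sched_cost Kstar < sched_cost K].

End Problem.

(* Main.v *)
Require Import Defs.
From HB Require Import structures.
From mathcomp Require Import all_boot all_order all_algebra.
From mathcomp Require Import complex.
From mathcomp Require Import all_classical all_reals all_analysis.
From mathcomp Require Import ring lra.
Set Implicit Arguments.
Unset Strict Implicit.
Unset Printing Implicit Defensive.
Import Order.TTheory GRing.Theory Num.Theory.
Import numFieldNormedType.Exports.
Local Open Scope classical_set_scope.
Local Open Scope ring_scope.

(** Since [grad K = 0], the remainder field at [K] is half the starred gradient,
    so the numerator of the mismatch ratio is the pairing of [grad_star] with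
    [K - Kstar].  The exact cost-difference identity, summed over the grid, says
    that this pairing equals [J(K) - J(Kstar) + Q_H(K)].  Hence the ratio is
    [1 + (J(K) - J(Kstar)) / Q_H(K)], and [Q_H(K) > 0] because the deployed gains
    of [K] and [Kstar] must differ somewhere for the costs to differ.  The
    Lyapunov solutions exist, are unique and inherit positivity because the
    powers of a Schur stable matrix decay geometrically. *)

(** * Geometric decay of the powers of a Schur stable matrix *)

(** Stated over any [numFieldType], so that the estimate obtained over the complex numbers, where
    the eigenvalues live, can be brought back to the reals. *)
Definition decays (C : numFieldType) (m n : nat) (q : C)
    (U : nat -> 'M[C]_(m, n)) : Prop :=
  exists2 c, 0 <= c & forall k i j, `|U k i j| <= c * q ^+ k.

Lemma decays_cst (C : numFieldType) (m n : nat) (A : 'M[C]_(m, n)) :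
  decays 1 (fun=> A).
Proof.
exists (\sum_i \sum_j `|A i j|) => [|k i j].
  by apply: sumr_ge0 => i _; apply: sumr_ge0.
rewrite expr1n mulr1 (bigD1 i) //= (bigD1 j) //= -addrA lerDl.
by rewrite addr_ge0 // sumr_ge0 // => *; rewrite sumr_ge0.
Qed.

Lemma decays_mulmx (C : numFieldType) (m n p : nat) (q r : C)
    (U : nat -> 'M[C]_(m, n)) (V : nat -> 'M[C]_(n, p)) :
  decays q U -> decays r V -> decays (q * r) (fun k => U k *m V k).
Proof.
move=> [c c0 Uc] [e e0 Ve]; exists (c * e *+ n) => [|k i j].
  by rewrite mulrn_wge0 // mulr_ge0.
rewrite mxE (le_trans (ler_norm_sum _ _ _)) //.
rewrite mulrnAl -[n in _ *+ n]card_ord -sumr_const ler_sum // => a _.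
by rewrite normrM exprMn mulrACA ler_pM.
Qed.

Lemma decays_trmx (C : numFieldType) (m n : nat) (q : C)
    (U : nat -> 'M[C]_(m, n)) :
  decays q U -> decays q (fun k => (U k)^T).
Proof. by move=> [c c0 Uc]; exists c => // k i j; rewrite mxE. Qed.

Lemma decays_recurrence (C : numFieldType) (m n : nat) (q z : C)
    (U : nat -> 'M[C]_(m, n)) :
  `|z| < q -> decays q (fun k => U k.+1 - z *: U k) -> decays q U.
Proof.
move=> zq [c c0 Uc].
have q0 : 0 <= q by rewrite (le_trans _ (ltW zq)).
have qz : 0 < q - `|z| by rewrite subr_gt0.
have [b b0 Ub] := decays_cst (U 0%N).
(* The summand [b] covers k = 0, and C = c / (q - |z|) solves c + |z| C = q C, the balance required
   by the induction step. *)
exists (b + c / (q - `|z|)) => [|k i j].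
  by rewrite addr_ge0 // divr_ge0 // ltW.
elim: k => [|k IH].
  rewrite expr0 mulr1 (le_trans (Ub 0%N i j)) // expr0 mulr1 lerDl.
  by rewrite divr_ge0 // ltW.
have -> : U k.+1 i j = (U k.+1 - z *: U k) i j + z * U k i j.
  by rewrite !mxE subrK.
rewrite (le_trans (ler_normD _ _)) // normrM.
rewrite (le_trans (lerD (Uc k i j) (ler_wpM2l (normr_ge0 z) IH))) //.
rewrite exprS -subr_ge0.
have -> : (b + c / (q - `|z|)) * (q * q ^+ k) - (c * q ^+ k +
    `|z| * ((b + c / (q - `|z|)) * q ^+ k)) = b * (q - `|z|) * q ^+ k.
  by field; rewrite gt_eqF.
by rewrite !mulr_ge0 ?exprn_ge0 // ltW.
Qed.

(* Cayley-Hamilton, peeling one linear factor of the characteristic polynomial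
   at a time. *)
Lemma decays_exp (C : numClosedFieldType) (n : nat) (q : C) (A : 'M[C]_n.+1) :
  (forall z, eigenvalue A z -> `|z| < q) -> decays q (fun k => A ^+ k).
Proof.
move=> Aq; have [rs] := closed_field_poly_normal (char_poly A).
rewrite (monicP (char_poly_monic A)) scale1r => Ers.
have {Aq} : forall z, z \in rs -> `|z| < q.
  by move=> z zrs; apply: Aq; rewrite eigenvalue_root_char Ers root_prod_XsubC.
have : decays q (fun k => horner_mx A (\prod_(z <- rs) ('X - z%:P)) * A ^+ k).
  exists 0 => // k i j.
  by rewrite -Ers Cayley_Hamilton mul0r mxE normr0 mul0r.
elim: rs {Ers} => [|z rs IH] Hd Hrs.
  move: Hd; rewrite big_nil rmorph1; case=> c c0 Hc; exists c => // k i j.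
  by rewrite -[A ^+ k]mul1r.
apply: IH => [|y yrs]; last by rewrite Hrs // inE yrs orbT.
(* Let H be the product of the remaining factors evaluated at A. It commutes with A, so multiplying
   H A^k by A - z gives U (k+1) - z U k for U k = H A^k. *)
apply: (@decays_recurrence _ _ _ _ z); first by rewrite Hrs ?mem_head.
case: Hd => c c0 Hc; exists c => // k i j; have := Hc k i j.
rewrite big_cons rmorphM rmorphB /= horner_mx_X horner_mx_C.
set H := horner_mx _ _.
have -> : (A - z%:M) * H * A ^+ k = H * A ^+ k.+1 - z *: (H * A ^+ k).
  rewrite mulrBl mulrBl exprS mulrA; congr (_ - _); last first.
    by rewrite -mulrA; exact: mul_scalar_mx.
  by congr (_ * _); apply: commr_sym; exact: comm_horner_mx.
by [].
Qed.

(** Turns decay into a sign. It is applied to |X i j| for uniqueness in the Lyapunov equation, and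
    to minus a quadratic form for positivity. *)
Lemma le0_geometric (R : realType) (q c y : R) :
  `|q| < 1 -> (forall k, y <= c * q ^+ k) -> y <= 0.
Proof.
move=> q1 Hy.
have Hc : c * q ^+ k @[k --> \oo] --> (0 : R).
  have : c * q ^+ k @[k --> \oo] --> c * 0.
    by apply: cvgMl_tmp; exact: cvg_expr.
  by rewrite mulr0.
apply: (ler_cvg_to (cvg_cst y) Hc).
by apply: nearW.
Qed.

(** A supremum dominates its set only once the set is known to be bounded; the sum of the moduli of
    all roots of the characteristic polynomial is a bound. *)
Lemma eigenvalue_le_spectral_radius (R : realType) (n : nat) (F : 'M[R]_n)
    (z : R[i]) : eigenvalue (map_mx (real_complex R) F) z ->
  ComplexField.Normc.normc z <= spectral_radius F.
Proof.
move=> Fz; apply: ub_le_sup; last by exists z.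
have [rs Ers] :=
  closed_field_poly_normal (char_poly (map_mx (real_complex R) F)).
rewrite (monicP (char_poly_monic _)) scale1r in Ers.
have normc_ge0 (x : R[i]) : 0 <= ComplexField.Normc.normc x.
  by case: x => a b; rewrite sqrtr_ge0.
exists (\sum_(x <- rs) ComplexField.Normc.normc x) => _ [x /= Fx <-].
have xrs : x \in rs by rewrite -root_prod_XsubC -Ers -eigenvalue_root_char.
by rewrite (big_rem x) //= lerDl sumr_ge0.
Qed.

Definition powers_vanish (R : realType) (n : nat) (F : 'M[R]_n) : Prop :=
  exists2 q, 0 <= q < 1 & decays q (fun k => F ^+ k).

Lemma schur_stable_powers_vanish (R : realType) (n : nat) (F : 'M[R]_n) :
  schur_stable F -> powers_vanish F.
Proof.
case: n F => [|n] F Fs.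
  by exists 0; rewrite ?lexx ?ltr01 //; exists 0 => // k [].
(* A midpoint, because [decays_exp] wants a rate strictly above every eigenvalue modulus; the
   maximum with 0 makes q nonnegative at once. *)
pose q := (1 + Num.max 0 (spectral_radius F)) / 2.
have [q0 q1 rq] : [/\ 0 <= q, q < 1 & spectral_radius F < q].
  have := Fs; rewrite /schur_stable /q => Fs'.
  by case: (leP 0 (spectral_radius F)) => ?; split; lra.
exists q; first by rewrite q0.
have [c c0 Hc] : decays q%:C%C (fun k => (map_mx (real_complex R) F) ^+ k).
  apply: decays_exp => z Fz.
  have := eigenvalue_le_spectral_radius Fz.
  case: z {Fz} => a b ab; rewrite normc_def ltcR /=.
  exact: le_lt_trans ab rq.
(* In the order of [R[i]], 0 <= c forces the imaginary part of c to vanish. *)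
have [c' c'0 c'E] : exists2 c' : R, 0 <= c' & c = c'%:C%C.
  case: c c0 {Hc} => a b; rewrite lecE /= => /andP[/eqP-> a0].
  by exists a.
exists c' => // k i j; have := Hc k i j.
rewrite -rmorphXn mxE normc_def /= expr0n /= addr0 sqrtr_sqr c'E.
by rewrite -rmorphXn -rmorphM lecR.
Qed.

Lemma powers_vanish_trmx (R : realType) (n : nat) (F : 'M[R]_n) :
  powers_vanish F -> powers_vanish F^T.
Proof.
move=> [q q01 Fq]; exists q => //.
have [c c0 Fc] := decays_trmx Fq; exists c => // k i j.
suff -> : F^T ^+ k = (F ^+ k)^T by [].
elim: k {i j} => [|k IH]; first by rewrite !expr0; exact/esym/trmx1.
by rewrite exprS exprSr IH; exact/esym/trmx_mul.
Qed.

(** * The discrete Lyapunov equation *)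

(** These are the iterates at X of the map X -> F X F^T; the two outer factors give the rate q^2. *)
Lemma powers_vanish_congr (R : realType) (n : nat) (F X : 'M[R]_n) :
  powers_vanish F ->
  exists2 r, `|r| < 1 & decays r (fun k => F ^+ k *m X *m (F ^+ k)^T).
Proof.
move=> [q /andP[q0 q1] Fq]; exists (q * 1 * q).
  by rewrite mulr1 ger0_norm ?mulr_ge0 // mulr_ilt1.
by apply: decays_mulmx (decays_trmx Fq); apply: decays_mulmx (decays_cst X).
Qed.

(** A fixed point of X -> F X F^T equals all its iterates, and these tend to 0. *)
Lemma lyap_homogeneous_eq0 (R : realType) (n : nat) (F X : 'M[R]_n) :
  powers_vanish F -> X = F *m X *m F^T -> X = 0.
Proof.
move=> /(powers_vanish_congr X)[r r1 [c c0 Fc]] XE.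
have XkE k : F ^+ k *m X *m (F ^+ k)^T = X.
  elim: k => [|k IH].
    by rewrite expr0 -[1]/(1%:M) trmx1 mul1mx mulmx1.
  rewrite exprS -[F * _]/(F *m _) trmx_mul.
  transitivity (F *m (F ^+ k *m X *m (F ^+ k)^T) *m F^T).
    by rewrite !mulmxA.
  by rewrite IH -XE.
apply/matrixP => i j; apply/eqP; rewrite mxE -normr_le0.
apply: (le0_geometric r1 (c := c)) => k.
by have := Fc k i j; rewrite XkE.
Qed.

(** The endomorphism X -> X - F X F^T of a finite-dimensional space is injective by the homogeneous
    case, hence onto; so [xget] picks a genuine solution instead of its default 0. *)
Lemma lyap_solE (R : realType) (n : nat) (F M : 'M[R]_n) :
  powers_vanish F -> lyap_sol F M = F *m lyap_sol F M *m F^T + M.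
Proof.
move=> Fv; apply: (xgetPex 0 (P := [set X | X = F *m X *m F^T + M])).
pose f := linfun (idfun \- (mulmxr F^T \o mulmx F)).
have fE X : f X = X - F *m X *m F^T by rewrite lfunE.
have f0 : lker f == 0%VS.
  apply/lker0P => X Y; rewrite !fE => XY; apply/eqP; rewrite -subr_eq0.
  apply/eqP/(lyap_homogeneous_eq0 Fv); rewrite mulmxBr mulmxBl.
  rewrite -[X in X - _ = _](subrK (F *m X *m F^T)) XY.
  by rewrite addrAC [Y - _]addrC addrK addrC.
exists (f^-1%VF M) => /=.
by rewrite -{3}(lker0_lfunVK f0 M) fE addrC subrK.
Qed.

(** The transpose solves the same equation, so its difference with the solution solves the
    homogeneous one. *)
Lemma lyap_sol_sym (R : realType) (n : nat) (F M : 'M[R]_n) :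
  powers_vanish F -> M^T = M -> (lyap_sol F M)^T = lyap_sol F M.
Proof.
move=> Fv MT; have XE := lyap_solE M Fv; set X := lyap_sol F M in XE *.
apply/eqP; rewrite -subr_eq0; apply/eqP/(lyap_homogeneous_eq0 Fv).
rewrite {1 2}XE raddfD /= !trmx_mul trmxK MT mulmxBr mulmxBl mulmxA.
by rewrite opprD addrACA subrr addr0.
Qed.

(** No series is summed: by the equation, the quadratic form of X does not increase when its
    argument is multiplied by F^T. Along the powers of F^T it tends to 0, hence it is nonnegative,
    and one more use of the equation gives the bound. *)
Lemma lyap_sol_ge (R : realType) (n : nat) (F M : 'M[R]_n) (x : 'cV[R]_n) :
  powers_vanish F -> (forall y : 'cV[R]_n, 0 <= (y^T *m M *m y) 0 0) ->
  (x^T *m M *m x) 0 0 <= (x^T *m lyap_sol F M *m x) 0 0.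
Proof.
move=> Fv M0; have XE := lyap_solE M Fv; set X := lyap_sol F M in XE *.
have step (y : 'cV[R]_n) : (y^T *m X *m y) 0 0 =
    ((F^T *m y)^T *m X *m (F^T *m y)) 0 0 + (y^T *m M *m y) 0 0.
  by rewrite {1}XE mulmxDr mulmxDl mxE trmx_mul trmxK !mulmxA.
suff X0 (y : 'cV[R]_n) : 0 <= (y^T *m X *m y) 0 0 by rewrite step lerDr.
have [r r1 Fr] := powers_vanish_congr X Fv.
have := decays_mulmx (decays_mulmx (decays_cst y^T) Fr) (decays_cst y).
rewrite mul1r mulr1 => -[c c0 Fc].
rewrite -oppr_le0; apply: (le0_geometric r1 (c := c)) => k.
apply: le_trans (le_trans _ (Fc k 0 0)); last first.
  by rewrite -normrN; exact: ler_norm.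
rewrite lerN2 => {Fc}; elim: k y => [|k IH] y.
  by rewrite expr0 -[1]/(1%:M) trmx1 mul1mx mulmx1.
rewrite step exprS -[F * _]/(F *m _).
apply: (le_trans _ (_ : ((F^T *m y)^T *m X *m (F^T *m y)) 0 0 <= _)).
  have := IH (F^T *m y); rewrite !trmx_mul trmxK !mulmxA //.
by rewrite lerDl.
Qed.

(** * Positive definite matrices and positivity of weighted traces *)

Lemma posdef_ge0 (R : realType) (n : nat) (M : 'M[R]_n) (x : 'cV[R]_n) :
  posdef M -> 0 <= (x^T *m M *m x) 0 0.
Proof.
move=> [_ Mp]; have [->|/Mp/ltW//] := eqVneq x 0.
by rewrite mulmx0 mxE.
Qed.

Lemma posdef_lyap_sol (R : realType) (n : nat) (F M : 'M[R]_n) :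
  powers_vanish F -> posdef M -> posdef (lyap_sol F M).
Proof.
move=> Fv Mp; split; first by apply: lyap_sol_sym => //; case: Mp.
move=> x x0; have [_ /(_ x x0) lt0] := Mp.
by apply: lt_le_trans lt0 _; apply: lyap_sol_ge => // y; exact: posdef_ge0.
Qed.

(** Cholesky factorization, by induction on the dimension through the Schur complement [S] of the
    top left entry. *)
Lemma posdef_gram (R : realType) (n : nat) (M : 'M[R]_n) :
  posdef M -> exists G : 'M[R]_n, M = G^T *m G.
Proof.
elim: n M => [|n IH] M; first by exists 0; rewrite mulmx0 [M]flatmx0.
rewrite -[n.+1]/(1 + n)%N in M * => -[MT Mp].
have [a [b [C ME]]] : exists a (b : 'rV[R]_n) (C : 'M[R]_n),
    M = block_mx (a%:M : 'M[R]_1) b b^T C.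
  exists (ulsubmx M 0 0), (ursubmx M), (drsubmx M).
  rewrite -mx11_scalar.
  by rewrite trmx_ursub MT submxK.
have CT : C^T = C.
  move: MT; rewrite ME tr_block_mx.
  by move/(congr1 drsubmx); rewrite !block_mxKdr.
have a0 : 0 < a.
  have := Mp (col_mx (1%:M : 'M[R]_1) 0); rewrite ME tr_col_mx trmx1 trmx0.
  rewrite mul_row_block mul_row_col !mul1mx !mul0mx !mulmx1 mulmx0 !addr0.
  rewrite mxE eqxx mulr1n; apply; apply/negP => /eqP.
  move/(congr1 usubmx); rewrite col_mxKu linear0 => /matrixP/(_ 0 0).
  by rewrite !mxE => /eqP; rewrite oner_eq0.
pose S := C - a^-1 *: (b^T *m b).
have Sp : posdef S.
  split; first by rewrite /S raddfB /= CT linearZ /= trmx_mul trmxK.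
  (* The upper coordinate minimizes the form of M for fixed x: M then sends the vector to (0, S x),
     so its form is that of S at x. *)
  move=> x x0; have := Mp (col_mx (- a^-1 *: (b *m x)) x).
  rewrite -!mulmxA; have -> : M *m col_mx (- a^-1 *: (b *m x)) x = col_mx 0 (S *m x).
    rewrite ME mul_block_col; congr col_mx.
      by rewrite mul_scalar_mx scalerA mulrN mulfV ?gt_eqF // scaleN1r addNr.
    by rewrite -scalemxAr scaleNr /S mulmxBl -scalemxAl mulmxA addrC.
  rewrite tr_col_mx mul_row_col mulmx0 add0r; apply.
  by apply: contra x0 => /eqP/(congr1 dsubmx); rewrite col_mxKd linear0 => ->.
have [G SE] := IH S Sp.
pose r := Num.sqrt a; have r0 : r != 0 by rewrite gt_eqF ?sqrtr_gt0.
have rr : r * r = a by rewrite -expr2 sqr_sqrtr ?ltW.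
exists (block_mx (r%:M : 'M[R]_1) (r^-1 *: b) 0 G).
rewrite tr_block_mx mulmx_block ME.
rewrite tr_scalar_mx !linearZ /= trmx0 !mul0mx !mulmx0 !addr0 -SE.
rewrite -!scalar_mxM rr !mul_scalar_mx mul_mx_scalar.
rewrite !scalerA mulfV // mulVf // !scale1r -scalemxAl scalerA -invfM rr.
by rewrite /S addrC subrK.
Qed.

(** With Sig = G^T G the trace is the sum of the forms of H at the columns of D G^T. If it vanished,
    then D G^T = 0 and so D Sig = 0, which contradicts definiteness of Sig at a nonzero row of D. *)
Lemma mxtrace_posdef_gt0 (R : realType) (m n : nat) (Sig : 'M[R]_n)
    (H : 'M[R]_m) (D : 'M[R]_(m, n)) :
  posdef Sig -> posdef H -> D != 0 -> 0 < \tr (Sig *m D^T *m H *m D).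
Proof.
move=> Sp Hp D0; have [G SE] := posdef_gram Sp.
have trE : \tr (Sig *m D^T *m H *m D) =
    \sum_j ((col j (D *m G^T))^T *m H *m col j (D *m G^T)) 0 0.
  rewrite {1}SE -!mulmxA mxtrace_mulC.
  have -> : G *m (D^T *m (H *m D)) *m G^T = (D *m G^T)^T *m H *m (D *m G^T).
    by rewrite trmx_mul trmxK !mulmxA.
  apply: eq_bigr => j _; rewrite tr_col -row_mul !mxE.
  by apply: eq_bigr => i _; rewrite !mxE.
rewrite trE lt_neqAle sumr_ge0 ?andbT; last by move=> *; exact: posdef_ge0.
apply/eqP => /esym/eqP; rewrite psumr_eq0 => [/allP DG|*]; last exact: posdef_ge0.
have DG0 : D *m G^T = 0.
  apply/matrixP => i j; rewrite [RHS]mxE.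
  have /eqP/matrixP/(_ i 0) : col j (D *m G^T) == 0.
    apply: contraT => /(proj2 Hp _); have /eqP -> := DG j (mem_index_enum _).
    by rewrite ltxx.
  by rewrite !mxE.
case/negP: D0; apply/eqP/row_matrixP => i; rewrite row0.
apply/eqP; apply: contraT => Di.
have := proj2 Sp (row i D)^T; rewrite trmxK -row_mul SE mulmxA DG0 mul0mx row0.
rewrite mul0mx mxE ltxx; apply.
by rewrite -trmx0 (inj_eq trmx_inj).
Qed.

(** * The exact cost-difference identity, as matrix algebra *)

Lemma mxtrace_quad_expand (R : comPzRingType) (m n : nat) (S : 'M[R]_m)
    (Sig : 'M[R]_n) (X Y : 'M[R]_(m, n)) : S^T = S -> Sig^T = Sig ->
  \tr ((X + Y)^T *m S *m (X + Y) *m Sig) = \tr (X^T *m S *m X *m Sig) +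
    2 * \tr (Y^T *m S *m X *m Sig) + \tr (Y^T *m S *m Y *m Sig).
Proof.
move=> ST SigT; rewrite [(X + Y)^T]raddfD /= !(mulmxDl, mulmxDr) !mxtraceD.
(* The two cross terms agree: transpose under the trace, then rotate cyclically. *)
have -> : \tr (X^T *m S *m Y *m Sig) = \tr (Y^T *m S *m X *m Sig).
  by rewrite -mxtrace_tr !trmx_mul trmxK ST SigT mxtrace_mulC !mulmxA.
by ring.
Qed.

(* Pairing the Stein equation of L - the one with closed loop A - B L - with P
   removes P' from the cost difference, leaving the Bellman residual of P. *)
Lemma cost_difference (R : comPzRingType) (m n : nat) (A Q P P' Sig W : 'M[R]_n)
    (B : 'M[R]_(n, m)) (Rc : 'M[R]_m) (K L : 'M[R]_(m, n))
    (H := Rc + B^T *m P *m B) (E := H *m K - B^T *m P *m A) :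
  P^T = P -> Rc^T = Rc -> Sig^T = Sig ->
  P = (A - B *m K)^T *m P *m (A - B *m K) + (Q + K^T *m Rc *m K) ->
  P' = (A - B *m L)^T *m P' *m (A - B *m L) + (Q + L^T *m Rc *m L) ->
  Sig = (A - B *m L) *m Sig *m (A - B *m L)^T + W ->
  \tr (P *m W) - \tr (P' *m W) = 2 * \tr ((E *m Sig)^T *m (K - L)) -
    \tr (Sig *m (K - L)^T *m H *m (K - L)).
Proof.
move=> PT RT SigT PE P'E SigE.
set D := K - L; set F := A - B *m K in PE; set F' := A - B *m L in P'E SigE.
(* Both F' and L are perturbations, of F and K, driven by D. In the two quadratic expansions the
   cross terms combine into E, by its closed-loop form [EE], and the squares into H. *)
have F'E : F' = F + B *m D by rewrite /F /D mulmxBr addrA subrK.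
have LE : L = K + - D by rewrite opprB addrC subrK.
have EE : E = Rc *m K - B^T *m P *m F.
  by rewrite /E /H /F mulmxDl mulmxBr !mulmxA opprB addrA.
have HE : H = Rc + B^T *m P *m B by [].
clearbody E H D F F'.
have WE (X : 'M[R]_n) : \tr (X *m W) = \tr (X *m Sig) - \tr (F'^T *m X *m F' *m Sig).
  have -> : \tr (F'^T *m X *m F' *m Sig) = \tr (X *m (F' *m Sig *m F'^T)).
    by rewrite [in RHS]mulmxA [RHS]mxtrace_mulC !mulmxA.
  by rewrite {1}SigE mulmxDr mxtraceD [X in X - _]addrC addrK.
rewrite !WE {1}PE {1}P'E [in F'^T *m P *m F']F'E.
rewrite !(mulmxDl _ _ Sig) !mxtraceD mxtrace_quad_expand //.
rewrite [in L^T *m _ *m _]LE mxtrace_quad_expand //.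
have -> : \tr ((E *m Sig)^T *m D) = \tr (D^T *m E *m Sig).
  by rewrite -mxtrace_tr trmx_mul trmxK mulmxA.
rewrite EE.
have -> : \tr (Sig *m D^T *m H *m D) = \tr (D^T *m Rc *m D *m Sig) +
    \tr ((B *m D)^T *m P *m (B *m D) *m Sig).
  rewrite -!mulmxA mxtrace_mulC !mulmxA HE mulmxDr !mulmxDl mxtraceD.
  by rewrite trmx_mul !mulmxA.
rewrite mulmxBr mulmxBl raddfB /= [(- D)^T]raddfN /= trmx_mul.
rewrite !(mulNmx, mulmxN) opprK !raddfN /= !mulmxA.
by ring.
Qed.

(** * Lyapunov matrices and cost difference of a single plant *)

Section Plant.
Variables (R : realType) (T : topologicalType) (n m N S : nat).
Variables (d : problem R T n m N S).
Hypotheses (Q_pd : posdef (Qcost d)) (R_pd : posdef (Rcost d)).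
Hypothesis Sigma0_pd : posdef (Sigma0 d).

Lemma stabilizes_powers_vanish s K : stabilizes d s K -> powers_vanish (Acl d s K).
Proof. exact: schur_stable_powers_vanish. Qed.

Lemma stage_cost_sym (K : 'M[R]_(m, n)) :
  (Qcost d + K^T *m Rcost d *m K)^T = Qcost d + K^T *m Rcost d *m K.
Proof.
by rewrite raddfD /= !trmx_mul trmxK (proj1 Q_pd) (proj1 R_pd) mulmxA.
Qed.

Lemma stage_cost_ge0 (K : 'M[R]_(m, n)) (x : 'cV[R]_n) :
  0 <= (x^T *m (Qcost d + K^T *m Rcost d *m K) *m x) 0 0.
Proof.
rewrite mulmxDr mulmxDl mxE addr_ge0 ?(posdef_ge0 _ Q_pd) //.
by have := posdef_ge0 (K *m x) R_pd; rewrite trmx_mul !mulmxA.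
Qed.

Lemma Pmx_sym s K : stabilizes d s K -> (Pmx d s K)^T = Pmx d s K.
Proof.
move=> /stabilizes_powers_vanish/powers_vanish_trmx Fv.
by apply: lyap_sol_sym => //; exact: stage_cost_sym.
Qed.

Lemma posdef_Hmx s K : stabilizes d s K -> posdef (Hmx d s K).
Proof.
move=> Ks; split.
  by rewrite /Hmx raddfD /= !trmx_mul trmxK Pmx_sym // (proj1 R_pd) mulmxA.
move=> x x0; rewrite /Hmx mulmxDr mulmxDl mxE ltr_wpDr //; last exact: (proj2 R_pd).
have := stabilizes_powers_vanish Ks => /powers_vanish_trmx Fv.
(* P dominates the stage cost matrix, so its form at B x is nonnegative. *)
have := lyap_sol_ge (Brho d (rho d s) *m x) Fv (stage_cost_ge0 K).
rewrite -/(Pmx d s K) trmx_mul !mulmxA; apply: le_trans.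
by have := stage_cost_ge0 K (Brho d (rho d s) *m x); rewrite trmx_mul !mulmxA.
Qed.

Lemma posdef_Sigmamx s K : stabilizes d s K -> posdef (Sigmamx d s K).
Proof. by move=> Ks; apply/posdef_lyap_sol/Sigma0_pd/stabilizes_powers_vanish. Qed.

(** E and H are taken at K but the covariance at L: with L the optimal deployed gain, this is the
    mixture found in [grad_star] and [QH]. *)
Lemma plant_cost_difference s K L : stabilizes d s K -> stabilizes d s L ->
  plant_cost d s K - plant_cost d s L =
    2 * \tr ((Emx d s K *m Sigmamx d s L)^T *m (K - L)) -
    \tr (Sigmamx d s L *m (K - L)^T *m Hmx d s K *m (K - L)).
Proof.
move=> Ks Ls.
have Kv := stabilizes_powers_vanish Ks; have Lv := stabilizes_powers_vanish Ls.
apply: (cost_difference (Q := Qcost d)).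
- exact: Pmx_sym.
- exact: (proj1 R_pd).
- by have [] := posdef_Sigmamx Ls.
- by have := lyap_solE (Qcost d + K^T *m Rcost d *m K) (powers_vanish_trmx Kv);
    rewrite trmxK.
- by have := lyap_solE (Qcost d + L^T *m Rcost d *m L) (powers_vanish_trmx Lv);
    rewrite trmxK.
- exact: lyap_solE.
Qed.

End Plant.

(** * Summation over the grid and conclusion *)

Lemma deployedB (R : realType) (T : topologicalType) (n m N S : nat)
    (d : problem R T n m N S) (K L : {ffun 'I_N -> 'M[R]_(m, n)}) s :
  deployed d (K - L) s = deployed d K s - deployed d L s.
Proof.
by rewrite /deployed -sumrB; apply: eq_bigr => i _; rewrite !ffunE scalerBr.
Qed.

(** The weights in the blocks of [grad_star] are those of the deployed gain, so exchanging the sums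
    over i and s reassembles the blocks of K - L into a difference of deployed gains. *)
Lemma inner_grad_star (R : realType) (T : topologicalType) (n m N S : nat)
    (d : problem R T n m N S) (Kstar K L : {ffun 'I_N -> 'M[R]_(m, n)}) :
  inner (grad_star d Kstar K) (K - L) = \sum_(s < S) nu d s *
    (2 * \tr ((Emx d s (deployed d K s) *m Sigmamx d s (deployed d Kstar s))^T
      *m (deployed d K s - deployed d L s))).
Proof.
under eq_bigr => s _.
  rewrite -deployedB {3}/deployed mulmx_sumr raddf_sum /= mulrA mulr_sumr; over.
rewrite exchange_big; apply: eq_bigr => i _.
rewrite !ffunE linearZ /= -scalemxAl mxtraceZ raddf_sum /= mulmx_suml.
rewrite raddf_sum /= mulr_sumr; apply: eq_bigr => s _.
by rewrite linearZ /= -scalemxAl -scalemxAr !mxtraceZ; ring.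
Qed.

Lemma sched_cost_difference (R : realType) (T : topologicalType) (n m N S : nat)
    (d : problem R T n m N S) (Kstar K : {ffun 'I_N -> 'M[R]_(m, n)}) :
  posdef (Qcost d) -> posdef (Rcost d) -> posdef (Sigma0 d) ->
  feasible d Kstar -> feasible d K ->
  sched_cost d K - sched_cost d Kstar =
    inner (grad_star d Kstar K) (K - Kstar) - QH d Kstar K.
Proof.
move=> Qp Rp Sp Ksf Kf; rewrite inner_grad_star /sched_cost /QH -!sumrB.
by apply: eq_bigr => s _; rewrite -!mulrBr plant_cost_difference.
Qed.

(** Every term is nonnegative, and positive where the deployed gains differ. If the sum vanished,
    all deployed gains would agree, and with them the costs, which see a schedule only through these
    gains. *)
Lemma QH_gt0 (R : realType) (T : topologicalType) (n m N S : nat)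
    (d : problem R T n m N S) (Kstar K : {ffun 'I_N -> 'M[R]_(m, n)}) :
  (forall s, 0 < nu d s) ->
  posdef (Qcost d) -> posdef (Rcost d) -> posdef (Sigma0 d) ->
  feasible d Kstar -> feasible d K ->
  sched_cost d Kstar != sched_cost d K -> 0 < QH d Kstar K.
Proof.
move=> nu0 Qp Rp Sp Ksf Kf neqJ.
have tr_gt0 s : deployed d K s - deployed d Kstar s != 0 ->
    0 < nu d s * \tr (Sigmamx d s (deployed d Kstar s) *m
      (deployed d K s - deployed d Kstar s)^T *m Hmx d s (deployed d K s) *m
      (deployed d K s - deployed d Kstar s)).
  move=> Ds; apply: mulr_gt0 => //; apply: mxtrace_posdef_gt0 => //.
    exact: posdef_Sigmamx.
  exact: posdef_Hmx.
have tr_ge0 s : 0 <= nu d s * \tr (Sigmamx d s (deployed d Kstar s) *m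
      (deployed d K s - deployed d Kstar s)^T *m Hmx d s (deployed d K s) *m
      (deployed d K s - deployed d Kstar s)).
  have [->|/tr_gt0/ltW//] := eqVneq (deployed d K s - deployed d Kstar s) 0.
  by rewrite mulmx0 mxtrace0 mulr0.
rewrite lt_neqAle sumr_ge0 // andbT eq_sym.
apply: contra neqJ => /eqP/psumr_eq0P QH0; apply/eqP/eq_bigr => s _.
congr (_ * plant_cost _ _ _); apply/esym/eqP; rewrite -subr_eq0.
by apply: contraT => /tr_gt0; rewrite QH0 // ltxx.
Qed.

Unset Implicit Arguments.

Theorem mainTheorem4 (R : realType) (T : topologicalType) (n m N S : nat)
  (d : problem R T n m N S)
  (nu_gt0 : forall s, 0 < nu d s)
  (nu_sum1 : \sum_(s < S) nu d s = 1)
  (w_cont : forall i, continuous (w d i))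
  (w_ge0 : forall i r, 0 <= w d i r)
  (w_sum1 : forall r, \sum_(i < N) w d i r = 1)
  (Q_pd : posdef (Qcost d))
  (R_pd : posdef (Rcost d))
  (Sigma0_pd : posdef (Sigma0 d))
  (feasible_neq0 : feasible d !=set0)
  (Gw_pd : posdef (Gw d))
  (Kstar : {ffun 'I_N -> 'M[R]_(m, n)})
  (Kstar_min : is_minimizer d Kstar)
  (K : {ffun 'I_N -> 'M[R]_(m, n)})
  (K_spurious : spurious_stationary d Kstar K) :
  1 < mismatch d Kstar K.
Proof.
have [Kf gradK0 JK] := K_spurious; have [Ksf _] := Kstar_min.
have QH0 : 0 < QH d Kstar K by apply: QH_gt0 => //; rewrite lt_eqF.
rewrite /mismatch /remainder gradK0 subr0.
have -> : 2 * inner (2^-1 *: grad_star d Kstar K) (K - Kstar) =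
    inner (grad_star d Kstar K) (K - Kstar).
  rewrite /inner mulr_sumr; apply: eq_bigr => i _.
  by rewrite ffunE linearZ /= -scalemxAl mxtraceZ mulrA divff ?mul1r ?pnatr_eq0.
(* With the positive denominator cleared, the gap between the two sides is exactly the excess cost
   of K over Kstar. *)
rewrite ltr_pdivlMr // mul1r -subr_gt0 -sched_cost_difference //.
by rewrite subr_gt0.
Qed.
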